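(* Let $(U,\bullet,\mathbb{1},\top,D)$ be a topped PCM and let $R$ be a separating relation on $U$. Put $D_R=\{z\in U\mid z\,R\,\mathbb{1}\}$ and $U/R = D_R\cup\{\top\}$, and for $x,y\in U/R$ define $x\bullet_{U/R}y = x\bullet y$ if $x\,R\,y$, and $x\bullet_{U/R}y=\top$ otherwise. Then $(U/R,\bullet_{U/R},\mathbb{1},\top,D_R)$ is a topped PCM, and it is a sub-PCM of $U$ via the injection $\iota:U/R\to U$, $\iota(x)=x$, with separating relation $\perp_{U/R}$, and the retraction $\rho:U\to U/R$ given by $\rho(u)=u$ if $u\,R\,\mathbb{1}$ and $\rho(u)=\top$ otherwise, with separating relation $R$.
   Context: A topped PCM is a tuple $(A,\bullet,\mathbb{1},\top,D)$ where $\bullet$ is a total commutative associative binary operation on $A$ with unit $\mathbb{1}$, $\top\in A$, and $D\subseteq A$ (the defined elements) satisfy: $\top\notin D$; $\mathbb{1}\in D$; if $x\bullet y\in D$ then $x,y\in D$; $x\bullet\top=\top\bullet x=\top$. Write $x\perp y$ (or $x\perp_A y$) for $x\bullet y\in D$; in particular $x\in D$ iff $x\perp\mathbb{1}$. A relation $R$ on $A$ is a separating relation if: (1) $x\,R\,y$ implies $x\,R\,\mathbb{1}$; (2) $x\,R\,y$ implies $x\perp y$; (3) $\mathbb{1}\,R\,\mathbb{1}$; (4) $x\,R\,y$ iff $y\,R\,x$; (5) $x\,R\,y$ and $(x\bullet y)\,R\,z$ imply $x\,R\,(y\bullet z)$ and $y\,R\,z$. The relation $\perp_A$ is called the trivial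 separating relation. A morphism $\phi:A\to B$ of topped PCMs with separating relation $\perp_\phi$ on $A$ is a function such that $\phi(\mathbb{1}_A)=\mathbb{1}_B$, $\phi(\top_A)=\top_B$, and $x\perp_\phi y$ implies $\phi(x)\perp\phi(y)$ and $\phi(x\bullet y)=\phi(x)\bullet\phi(y)$. It is total if $\perp_\phi$ equals $\perp_A$. A PCM $A$ is a sub-PCM of a PCM $B$ if there are a total morphism $\iota:A\to B$ (injection) and a morphism $\rho:B\to A$ (retraction) with: (1) $\rho(\iota(x))=x$ for all $x \in A$; (2) $u\perp_\rho\mathbb{1}$ implies $\iota(\rho(u))=u$; (3) $\rho(u)\perp_A\rho(v)$ implies $u\perp_\rho v$; (4) $\iota(x)\perp_B\mathbb{1}$ implies $x\perp_A\mathbb{1}$. *)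

(* Defs.v *)
From mathcomp Require Import all_boot boolp classical_sets.

Set Implicit Arguments.
Unset Strict Implicit.
Unset Printing Implicit Defensive.

Local Open Scope classical_set_scope.

Declare Scope pcm_scope.
Delimit Scope pcm_scope with pcm.

(* The bare tuple (A, •, 1, ⊤, D); the laws are in [is_topped_pcm]. *)
Record pcm_tuple := PcmTuple {
  carrier :> Type;
  op : carrier -> carrier -> carrier;
  unit : carrier;
  top : carrier;
  defined : set carrier
}.

Arguments op {p} x y.
Arguments unit {p}.
Arguments top {p}.
Arguments defined {p} x.

Notation "x • y" := (op x y) (at level 40, left associativity) : pcm_scope.
Notation "𝟙" := (@unit _) : pcm_scope.
Notation "⊤" := (@top _) : pcm_scope.
Local Open Scope pcm_scope.

Record is_topped_pcm (A : pcm_tuple) : Prop := IsToppedPcm {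
  opC : forall x y : A, x • y = y • x;
  opA : forall x y z : A, x • (y • z) = (x • y) • z;
  op1x : forall x : A, 𝟙 • x = x;
  opx1 : forall x : A, x • 𝟙 = x;
  top_undefined : ~ defined (⊤ : A);
  unit_defined : defined (𝟙 : A);
  defined_op : forall x y : A, defined (x • y) -> defined x /\ defined y;
  opxT : forall x : A, x • ⊤ = ⊤;
  opTx : forall x : A, ⊤ • x = ⊤
}.

Record topped_pcm := ToppedPcm {
  tuple_of :> pcm_tuple;
  topped_pcmP : is_topped_pcm tuple_of
}.

Definition perp (A : pcm_tuple) (x y : A) : Prop := defined (x • y).
Notation "x ⊥ y" := (perp x y) (at level 70, no associativity) : pcm_scope.

Record separating (A : topped_pcm) (R : A -> A -> Prop) : Prop := Separating {
  sep_unit : forall x y : A, R x y -> R x 𝟙;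
  sep_perp : forall x y : A, R x y -> x ⊥ y;
  sep_unit_unit : R 𝟙 𝟙;
  sep_sym : forall x y : A, R x y <-> R y x;
  sep_assoc : forall x y z : A,
    R x y -> R (x • y) z -> R x (y • z) /\ R y z
}.

Record morphism (A B : topped_pcm) (S : A -> A -> Prop) (phi : A -> B) : Prop :=
  Morphism {
  morph_sep : separating S;
  morph_unit : phi 𝟙 = 𝟙;
  morph_top : phi ⊤ = ⊤;
  morph_op : forall x y : A,
    S x y -> phi x ⊥ phi y /\ phi (x • y) = phi x • phi y
}.

Record total_morphism (A B : topped_pcm) (S : A -> A -> Prop) (phi : A -> B) :
  Prop := TotalMorphism {
  total_morph : morphism S phi;
  total_sep : forall x y : A, S x y <-> x ⊥ y
}.

(* [A] is a sub-PCM of [B] via the injection [iota], with separating relation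
   [Si], and the retraction [rho], with separating relation [Sr]. *)
Record sub_pcm_via (A B : topped_pcm)
    (Si : A -> A -> Prop) (iota : A -> B)
    (Sr : B -> B -> Prop) (rho : B -> A) : Prop := SubPcmVia {
  sub_iota : total_morphism Si iota;
  sub_rho : morphism Sr rho;
  sub_rhoK : forall x : A, rho (iota x) = x;
  sub_iotaK : forall u : B, Sr u 𝟙 -> iota (rho u) = u;
  sub_perp : forall u v : B, rho u ⊥ rho v -> Sr u v;
  sub_defined : forall x : A, iota x ⊥ 𝟙 -> x ⊥ 𝟙
}.

Section Quotient.
Variables (U : topped_pcm) (R : U -> U -> Prop).

Definition D_R : set U := [set z | R z 𝟙].
Definition quot_set : set U := D_R `|` [set ⊤].

Definition quot_op_val (x y : U) : U := if `[< R x y >] then x • y else ⊤.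
Definition rho_val (u : U) : U := if `[< R u 𝟙 >] then u else ⊤.

Lemma quot_top_in : ⊤ \in quot_set.
Proof. by apply/mem_set; right. Qed.

Lemma rho_val_in (u : U) : rho_val u \in quot_set.
Proof.
by apply/mem_set; rewrite /rho_val; case: asboolP => Ru; [left | right].
Qed.

Hypothesis sepR : separating R.

Lemma quot_unit_in : 𝟙 \in quot_set.
Proof. by apply/mem_set; left; exact: sep_unit_unit sepR. Qed.

Lemma quot_op_val_in (x y : U) : quot_op_val x y \in quot_set.
Proof.
apply/mem_set; rewrite /quot_op_val; case: asboolP => Rxy; [left | by right].
apply/(sep_sym sepR).
have R1x : R 𝟙 x by apply/(sep_sym sepR)/(sep_unit sepR Rxy).
have R1xy : R (𝟙 • x) y by rewrite (op1x (topped_pcmP U)).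
by have [] := sep_assoc sepR R1x R1xy.
Qed.

(* U/R; its carrier is the set [quot_set] coerced to a type. *)
Definition quotient : pcm_tuple := {|
  carrier := quot_set;
  op := fun x y => exist _ (quot_op_val (val x) (val y)) (quot_op_val_in _ _);
  unit := exist _ 𝟙 quot_unit_in;
  top := exist _ ⊤ quot_top_in;
  defined := [set x | D_R (val x)]
|}.

Definition quot_iota (x : quotient) : U := val x.
Definition quot_rho (u : U) : quotient := exist _ (rho_val u) (rho_val_in u).

End Quotient.

(* Main.v *)
Require Import Defs.
From mathcomp Require Import all_boot boolp classical_sets.

(** By the associativity axiom of a separating relation, [R x y] holds exactly
    when [x •_{U/R} y] lies in [D_R], so [x ⊥ y] in [U/R] is just [R x y]; and a
    triple product of [U/R] is either the product of [U] on both sides, or [⊤]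
    on both sides. *)

Set Implicit Arguments.
Unset Strict Implicit.
Unset Printing Implicit Defensive.

Local Open Scope classical_set_scope.
Local Open Scope pcm_scope.

(** Needed for the injection, whose separating relation is the trivial one. The fifth axiom comes
    down to associativity of [•] and to factors of a defined product being defined. *)
Lemma perp_separating (A : topped_pcm) : separating (@perp A).
Proof.
have PA := topped_pcmP A.
split; rewrite /perp.
- by move=> x y /(defined_op PA)[Dx _]; rewrite (opx1 PA).
- by [].
- by rewrite (op1x PA); exact: unit_defined PA.
- by move=> x y; rewrite (opC PA).
- move=> x y z _ Dxyz; rewrite (opA PA); split=> //.
  by move: Dxyz; rewrite -(opA PA) => /(defined_op PA)[].
Qed.

Section Separating.
Variables (U : topped_pcm) (R : U -> U -> Prop) (sepR : separating R).
Let PU := topped_pcmP U.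

Lemma sepC (x y : U) : R x y -> R y x.
Proof. by move/(sep_sym sepR). Qed.

Lemma sep_topNl (x : U) : ~ R ⊤ x.
Proof. by move/(sep_perp sepR); rewrite /perp (opTx PU); exact: top_undefined. Qed.

Lemma sep_topNr (x : U) : ~ R x ⊤.
Proof. by move/sepC/sep_topNl. Qed.

Lemma sep_unitr (x y : U) : R x y -> R y 𝟙.
Proof. by move/sepC/(sep_unit sepR). Qed.

(** The associativity axiom on the triple [𝟙], [x], [y] yields [R 𝟙 (x • y)]. *)
Lemma sep_op_unit (x y : U) : R x y -> R (x • y) 𝟙.
Proof.
move=> Rxy; apply: sepC.
have R1x : R 𝟙 x by exact: sepC (sep_unit sepR Rxy).
by have [|] := sep_assoc sepR R1x (z := y); rewrite ?(op1x PU).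
Qed.

(** Converse of the associativity axiom: apply it to the reversed triple [z], [y], [x], then use
    symmetry of [R] and commutativity of [•]. *)
Lemma sep_assocr (x y z : U) : R y z -> R x (y • z) -> R (x • y) z /\ R x y.
Proof.
move=> /sepC Rzy /sepC; rewrite (opC PU y) => Rzyx.
by have [/sepC + /sepC] := sep_assoc sepR Rzy Rzyx; rewrite (opC PU y).
Qed.

Lemma quot_op_valE (x y : U) : R x y -> quot_op_val R x y = x • y.
Proof. by rewrite /quot_op_val; case: asboolP. Qed.

Lemma quot_op_valN (x y : U) : ~ R x y -> quot_op_val R x y = ⊤.
Proof. by rewrite /quot_op_val; case: asboolP. Qed.

Lemma quot_op_valC (x y : U) : quot_op_val R x y = quot_op_val R y x.
Proof.
have [Rxy|NRxy] := pselect (R x y).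
  by rewrite !quot_op_valE ?(opC PU x)//; exact: sepC.
by rewrite !quot_op_valN// => /sepC.
Qed.

Lemma quot_op_valxT (x : U) : quot_op_val R x ⊤ = ⊤.
Proof. by rewrite quot_op_valN//; exact: sep_topNr. Qed.

Lemma quot_op_valTx (x : U) : quot_op_val R ⊤ x = ⊤.
Proof. by rewrite quot_op_valC quot_op_valxT. Qed.

Lemma quot_op_valA (x y z : U) :
  quot_op_val R x (quot_op_val R y z) = quot_op_val R (quot_op_val R x y) z.
Proof.
have [[Ryz Rxyz]|Nl] := pselect (R y z /\ R x (y • z)).
  have [Rxyz' Rxy] := sep_assocr Ryz Rxyz.
  by rewrite (quot_op_valE Ryz) (quot_op_valE Rxy) !quot_op_valE ?(opA PU).
(* Each side is [⊤]: were either product taken in [U] at both stages, both conditions in [Nl] would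
   hold, on the right-hand side by the associativity axiom. *)
transitivity (⊤ : U).
  have [Ryz|NRyz] := pselect (R y z); last by rewrite (quot_op_valN NRyz) quot_op_valxT.
  by rewrite (quot_op_valE Ryz) quot_op_valN// => Rxyz; apply: Nl.
have [Rxy|NRxy] := pselect (R x y); last by rewrite (quot_op_valN NRxy) quot_op_valTx.
rewrite (quot_op_valE Rxy) quot_op_valN// => Rxyz.
by apply: Nl; have [] := sep_assoc sepR Rxy Rxyz.
Qed.

(** Membership in [quot_set] matters: any [x] with [~ R x 𝟙] is sent to [⊤], so among these only [⊤]
    itself is fixed. *)
Lemma quot_op_valx1 (x : U) : quot_set R x -> quot_op_val R x 𝟙 = x.
Proof.
case=> [Rx1|->]; last exact: quot_op_valTx.
by rewrite quot_op_valE// (opx1 PU).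
Qed.

Lemma D_R_quot_op_val (x y : U) : D_R R (quot_op_val R x y) <-> R x y.
Proof.
split=> [|Rxy]; last by rewrite quot_op_valE//; exact: sep_op_unit.
have [//|NRxy] := pselect (R x y).
by rewrite quot_op_valN// => /sep_topNl.
Qed.

Lemma rho_valE (u : U) : R u 𝟙 -> rho_val R u = u.
Proof. by rewrite /rho_val; case: asboolP. Qed.

(** [⊤] is related to nothing, so neither value is the default [⊤], and both arguments are
    unchanged. *)
Lemma sep_rho_val (u v : U) : R (rho_val R u) (rho_val R v) -> R u v.
Proof.
rewrite /rho_val; case: asboolP => _; last by move/sep_topNl.
by case: asboolP => _ // /sep_topNr.
Qed.

Lemma rho_val_id (x : U) : quot_set R x -> rho_val R x = x.
Proof.
case=> [/rho_valE//|->].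
by rewrite /rho_val; case: asboolP.
Qed.

Lemma quot_valP (x : quotient sepR) : quot_set R (val x).
Proof. exact: set_mem (valP x). Qed.

Lemma quotient_topped : is_topped_pcm (quotient sepR).
Proof.
split.
- by move=> x y; apply: val_inj; exact: quot_op_valC.
- by move=> x y z; apply: val_inj; exact: quot_op_valA.
- move=> x; apply: val_inj; rewrite /= quot_op_valC.
  exact: quot_op_valx1 (quot_valP x).
- by move=> x; apply: val_inj; exact: quot_op_valx1 (quot_valP x).
(* Being defined in the quotient means [R _ 𝟙], which fails at [⊤]. *)
- exact: sep_topNl.
- exact: sep_unit_unit sepR.
- move=> x y /D_R_quot_op_val Rxy.
  by split; [exact: sep_unit sepR _ _ Rxy | exact: sep_unitr Rxy].
- by move=> x; apply: val_inj; exact: quot_op_valxT.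
- by move=> x; apply: val_inj; exact: quot_op_valTx.
Qed.

Lemma quot_perpE (x y : quotient sepR) : x ⊥ y <-> R (val x) (val y).
Proof. exact: D_R_quot_op_val. Qed.

Lemma quot_iota_total :
  @total_morphism (ToppedPcm quotient_topped) U (@perp _) (@quot_iota U R sepR).
Proof.
split=> //; split=> //; first exact: perp_separating.
move=> x y /quot_perpE Rxy.
by split; [exact: sep_perp sepR _ _ Rxy | exact: quot_op_valE].
Qed.

Lemma quot_rho_morphism :
  @morphism U (ToppedPcm quotient_topped) R (@quot_rho U R sepR).
Proof.
split=> //.
- by apply: val_inj; apply: rho_valE; exact: sep_unit_unit sepR.
- by apply: val_inj; apply: rho_val_id; right.
move=> x y Rxy.
have rx : rho_val R x = x by exact: rho_valE (sep_unit sepR Rxy).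
have ry : rho_val R y = y by exact: rho_valE (sep_unitr Rxy).
split; first by apply/quot_perpE; rewrite /= rx ry.
apply: val_inj; rewrite /= rx ry quot_op_valE//.
(* The product of related elements lies in [D_R], so the retraction fixes it. *)
exact: rho_valE (sep_op_unit Rxy).
Qed.

End Separating.

Theorem mainTheorem1 (U : topped_pcm) (R : U -> U -> Prop) (sepR : separating R) :
  exists quotP : is_topped_pcm (quotient sepR),
    let UR := ToppedPcm quotP in
    @sub_pcm_via UR U (@perp UR) (@quot_iota U R sepR) R (@quot_rho U R sepR).
Proof.
exists (quotient_topped sepR) => UR; split.
- exact: quot_iota_total.
- exact: quot_rho_morphism.
- by move=> x; apply: val_inj; exact: rho_val_id (quot_valP x).
- by move=> u; exact: rho_valE.
- by move=> u v /quot_perpE/(sep_rho_val sepR).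
- move=> x; rewrite /perp (opx1 (topped_pcmP U)) => Dx; apply/quot_perpE.
  (* Either [x] lies in [D_R], as wanted, or [x] is [⊤], which is undefined in [U]. *)
  case: (quot_valP x) => [//|xT]; move: Dx; rewrite /quot_iota xT.
  by move/(top_undefined (topped_pcmP U)).
Qed.
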